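(* Let $n\ge 1$. Every Clifford (stabilizer) circuit on $n$ qubits can be written, up to a global phase and multiplication by an $n$-qubit Pauli operator, in the layered form -P-C-P-C-H-C-P-C-P-. Equivalently, the symplectic matrix in $\mathrm{Sp}(2n,\mathbb{F}_2)$ of every Clifford circuit on $n$ qubits is the symplectic matrix of a circuit of the form -P-C-P-C-H-C-P-C-P-.
   Context: Clifford (stabilizer) circuits on $n$ qubits are circuits composed of the Hadamard gate $\mathrm{H}=\frac{1}{\sqrt2}\begin{pmatrix}1&1\\1&-1\end{pmatrix}$, the Phase gate $\mathrm{P}=\mathrm{diag}(1,i)$ and the controlled-NOT gate $\mathrm{CNOT}$, acting on any qubit (resp. any ordered pair of distinct qubits). An -H- (resp. -P-, -C-) layer is any unitary computable by a circuit consisting only of $\mathrm{H}$ (resp. $\mathrm{P}$, $\mathrm{CNOT}$) gates, the identity being allowed. A layered expression denotes circuits obtained by performing, in order from left to right, one layer of each indicated type. Modulo the group generated by the center (global phases) and the Pauli operators, the group of stabilizer circuits is isomorphic to $\mathrm{Sp}(2n,\mathbb{F}_2)=\{S\in\mathrm{GL}(2n,\mathbb{F}_2): S^tJS=J\}$ with $J=\begin{pmatrix}\mathbf 0_n&\mathbf 1_n\\ \mathbf 1_n&\mathbf 0_n\end{pmatrix}$. Under this correspondence, right multiplication of a symplectic matrix by the image of a Hadamard gate on qubit $k$ exchanges columns $k$ and $n+k$; by the image of a Phase gate on qubit $k$ adds column $k$ to column $n+k$; by the image of a $\mathrm{CNOT}$ with control $j$ and target $k$ adds column $j$ to column $k$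 and column $n+k$ to column $n+j$ (all modulo 2). *)

(* Defs.v *)
From HB Require Import structures.
From mathcomp Require Import all_boot all_order all_fingroup all_algebra.
Set Implicit Arguments. Unset Strict Implicit. Unset Printing Implicit Defensive.
Import Order.TTheory GRing.Theory Num.Theory.
Local Open Scope ring_scope.

Inductive gate (n : nat) : Type :=
| Hadamard of 'I_n
| Phase of 'I_n
| CNOT (control target : 'I_n) of control != target.

(* Gates are listed in the order in which they are performed. *)
Definition circuit (n : nat) : Type := seq (gate n).

Inductive layer_kind : Type := LH | LP | LC.

Definition has_kind (n : nat) (t : layer_kind) (g : gate n) : bool :=
  match t, g with
  | LH, Hadamard _ | LP, Phase _ | LC, CNOT _ _ _ => true
  | _, _ => false
  end.

(* The layers of w are performed from left to right; any of them may be
   empty, i.e. the identity. *)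
Fixpoint layered (n : nat) (w : seq layer_kind) (c : circuit n) : Prop :=
  match w with
  | [::] => c = [::]
  | t :: w' => exists c1 c2 : circuit n,
      [/\ c = c1 ++ c2, all (has_kind t) c1 & layered w' c2]
  end.

(* Computational basis states of n qubits; operators are matrices whose
   indices enumerate this type, which has 2 ^ n elements. *)
Notation basis n := {ffun 'I_n -> 'I_2}.
Notation "''Op[' C ]_ n" := ('M[C]_#|{: basis n}|)
  (at level 8, C at level 200, n at level 2, format "''Op[' C ]_ n").

Definition bits (n : nat) (x : 'I_#|{: basis n}|) : basis n := enum_val x.

Section Unitaries.

(* A field with the structure of the complex numbers, in particular R[i] for
   any model R of the reals. *)
Variable C : numClosedFieldType.

Definition mx2 (a b c d : C) : 'M[C]_2 :=
  \matrix_(i, j) if i == 0 then (if j == 0 then a else b)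
                 else (if j == 0 then c else d).

Definition Hmx : 'M[C]_2 := (sqrtC 2)^-1 *: mx2 1 1 1 (- 1).
Definition Pmx : 'M[C]_2 := mx2 1 0 0 'i.
Definition Xmx : 'M[C]_2 := mx2 0 1 1 0.
Definition Ymx : 'M[C]_2 := mx2 0 (- 'i) 'i 0.
Definition Zmx : 'M[C]_2 := mx2 1 0 0 (- 1).

Variable n : nat.

(* The tensor product of the U l, l < n. *)
Definition tensor (U : 'I_n -> 'M[C]_2) : 'Op[C]_n :=
  \matrix_(x, y) \prod_(l < n) U l (bits x l) (bits y l).

Definition on_qubit (k : 'I_n) (U : 'M[C]_2) : 'Op[C]_n :=
  tensor (fun l => if l == k then U else 1%:M).

(* The addition is modulo 2. *)
Definition cnot (j k : 'I_n) (y : basis n) : basis n :=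
  [ffun l => if l == k then y j + y k else y l].

Definition CNOTmx (j k : 'I_n) : 'Op[C]_n :=
  \matrix_(x, y) (bits x == cnot j k (bits y))%:R.

Definition gate_unitary (g : gate n) : 'Op[C]_n :=
  match g with
  | Hadamard k => on_qubit k Hmx
  | Phase k => on_qubit k Pmx
  | CNOT j k _ => CNOTmx j k
  end.

(* Operators act on column vectors, so the gate performed first is the
   rightmost factor. *)
Fixpoint unitary (c : circuit n) : 'Op[C]_n :=
  if c is g :: c' then unitary c' *m gate_unitary g else 1%:M.

Definition is_pauli (Q : 'Op[C]_n) : Prop :=
  exists2 p : 'I_n -> 'M[C]_2,
    (forall k, p k \in [:: 1%:M; Xmx; Ymx; Zmx]) & Q = tensor p.

Definition eq_mod_phase_pauli (U V : 'Op[C]_n) : Prop :=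
  exists (a : C) (Q : 'Op[C]_n),
    [/\ `|a| = 1, is_pauli Q & U = a *: (Q *m V)].

End Unitaries.

Section Symplectic.

Variable n : nat.

Definition Jmx : 'M['F_2]_(n + n) := block_mx 0 1%:M 1%:M 0.

Definition Sp : {set 'M['F_2]_(n + n)} :=
  [set S | (S \in unitmx) && (S^T *m Jmx *m S == Jmx)].

(* Column k (resp. n + k) has index lshift n k (resp. rshift n k), and right
   multiplication by 1%:M + delta_mx i j adds column i to column j. *)
Definition gate_symp (g : gate n) : 'M['F_2]_(n + n) :=
  match g with
  | Hadamard k => tperm_mx (lshift n k) (rshift n k)
  | Phase k => 1%:M + delta_mx (lshift n k) (rshift n k)
  | CNOT j k _ => 1%:M + delta_mx (lshift n j) (lshift n k)
                       + delta_mx (rshift n k) (rshift n j)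
  end.

(* Rows encode Pauli operators as (x | z), and the circuit acts on them by
   conjugation P |-> U P U^-1; the gate performed first is therefore the
   leftmost factor. *)
Fixpoint symp (c : circuit n) : 'M['F_2]_(n + n) :=
  if c is g :: c' then gate_symp g *m symp c' else 1%:M.

End Symplectic.

(* Main.v *)
Require Import Defs.
From mathcomp Require Import all_boot all_order all_fingroup all_algebra ring.
Set Implicit Arguments. Unset Strict Implicit. Unset Printing Implicit Defensive.
Import Order.TTheory GRing.Theory Num.Theory.
Local Open Scope ring_scope.

(* Let G be the Siegel parabolic subgroup of Sp(2n, F_2), the block upper
   triangular matrices [A, S A^-T; 0, A^-T] with S symmetric.  Over F_2 a
   symmetric S is D + N N^T with D diagonal and N invertible, and every A is a
   product of transvections; hence G is exactly what -P-C-P-C- computes, and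
   equally what -C-P-C-P- computes.  The Bruhat decomposition Sp = G W G, with W
   the partial Hadamard layers indexed by the rank of the lower left block, then
   gives the symplectic form of the result.
   For unitaries, if two circuits have the same symplectic matrix then their
   quotient K commutes with each Pauli operator up to a sign.  These signs are
   those of conjugation by some Pauli operator Q, so that Q K commutes with all
   Pauli operators and is scalar. *)

(** * Block matrices over F_2: shears, Levi factors and partial Hadamards *)

Definition shear_mx n (S : 'M['F_2]_n) : 'M['F_2]_(n + n) :=
  block_mx 1%:M S 0 1%:M.
(** The lower right block is the one that preservation of [Jmx] forces. *)
Definition levi_mx n (A : 'M['F_2]_n) : 'M['F_2]_(n + n) :=
  block_mx A 0 0 (invmx A)^T.
(** For diagonal [D] these are Hadamard gates on the qubits where [D] has a 1: there the two columns
    are exchanged, elsewhere they are kept. *)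
Definition had_mx n (D : 'M['F_2]_n) : 'M['F_2]_(n + n) :=
  block_mx (1%:M + D) D D (1%:M + D).

Lemma F2_neq0 (a : 'F_2) : a != 0 -> a = 1.
Proof. by case: a => [[|[|//]]] // ? _; apply/val_inj. Qed.

Lemma F2_double (a : 'F_2) : a + a = 0.
Proof. by rewrite -mulr2n mulrn_pchar ?pchar_Fp. Qed.

Lemma F2_addmxx m n (A : 'M['F_2]_(m, n)) : A + A = 0.
Proof. by apply/matrixP => i j; rewrite !mxE F2_double. Qed.

Lemma F2_addmxK m n (A B : 'M['F_2]_(m, n)) : A + (A + B) = B.
Proof. by rewrite addrA F2_addmxx add0r. Qed.

Lemma F2_oppmx m n (A : 'M['F_2]_(m, n)) : - A = A.
Proof. by apply/eqP; rewrite eq_sym -addr_eq0 F2_addmxx. Qed.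

Lemma shear_mxD n (S T : 'M['F_2]_n) :
  shear_mx S *m shear_mx T = shear_mx (S + T).
Proof.
by rewrite mulmx_block !mul0mx !mulmx0 !mul1mx !mulmx1 addr0 !add0r addrC.
Qed.

(** The product [S *m T] enters every block twice and so cancels in characteristic 2. *)
Lemma had_mxD n (S T : 'M['F_2]_n) : had_mx S *m had_mx T = had_mx (S + T).
Proof.
rewrite mulmx_block !mulmxDl !mulmxDr !mul1mx !mulmx1.
move: (S *m T) => P.
congr block_mx; apply/matrixP => i j; rewrite !mxE.
all: move: (P i j) (F2_double (P i j)) => p p0.
all: by ring: p0.
Qed.

Lemma invmxM n (A B : 'M['F_2]_n) : A \in unitmx -> B \in unitmx ->
  invmx (A *m B) = invmx B *m invmx A.
Proof.
move=> uA uB; have uAB : A *m B \in unitmx by rewrite unitmx_mul uA.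
apply: (can_inj (mulKmx uAB)).
by rewrite mulmxV // mulmxA mulmxK // mulmxV.
Qed.

Lemma levi_mxM n (A B : 'M['F_2]_n) : A \in unitmx -> B \in unitmx ->
  levi_mx A *m levi_mx B = levi_mx (A *m B).
Proof.
move=> uA uB; rewrite mulmx_block !mul0mx !mulmx0 !addr0 !add0r.
by rewrite /levi_mx invmxM // trmx_mul.
Qed.

Lemma delta_mx_block m1 m2 n1 n2 :
  [/\ forall i j, delta_mx (lshift m2 i) (lshift n2 j)
         = block_mx (delta_mx i j) 0 0 0 :> 'M['F_2]_(m1 + m2, n1 + n2),
      forall i j, delta_mx (lshift m2 i) (rshift n1 j)
         = block_mx 0 (delta_mx i j) 0 0 :> 'M['F_2]_(m1 + m2, n1 + n2) &
      forall i j, delta_mx (rshift m1 i) (rshift n1 j)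
         = block_mx 0 0 0 (delta_mx i j) :> 'M['F_2]_(m1 + m2, n1 + n2)].
Proof.
by split=> i j; rewrite ?delta_mx_ushift ?delta_mx_dshift;
  rewrite ?delta_mx_lshift ?delta_mx_rshift /block_mx row_mx0.
Qed.

(** * Symplectic matrices of single layers *)

Lemma symp_cat n (c d : circuit n) : symp (c ++ d) = symp c *m symp d.
Proof. by elim: c => [|g c IH] /=; rewrite ?mul1mx // IH mulmxA. Qed.

Lemma transv_sqr n (j k : 'I_n) : j != k ->
  (1%:M + delta_mx j k) *m (1%:M + delta_mx j k) = 1%:M :> 'M['F_2]_n.
Proof.
move=> jk; rewrite mulmxDl !mulmxDr !mul1mx mulmx1.
by rewrite mul_delta_mx_0 1?eq_sym // addr0 -addrA F2_addmxx addr0.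
Qed.

Lemma transv_unit n (j k : 'I_n) : j != k ->
  (1%:M + delta_mx j k : 'M['F_2]_n) \in unitmx.
Proof. by move/transv_sqr/mulmx1_unit => []. Qed.

Lemma gate_symp_CNOT n (j k : 'I_n) (jk : j != k) :
  gate_symp (CNOT jk) = levi_mx (1%:M + delta_mx j k).
Proof.
have -> : levi_mx (1%:M + delta_mx j k) =
    block_mx (1%:M + delta_mx j k) 0 0 (1%:M + delta_mx k j).
  congr block_mx; apply: trmx_inj; rewrite trmxK linearD /= trmx1 trmx_delta.
  apply: (can_inj (mulKmx (transv_unit jk))).
  by rewrite transv_sqr // mulmxV ?transv_unit.
have [dl _ dr] := delta_mx_block n n n n.
rewrite /gate_symp dl dr scalar_mx_block.
by rewrite !add_block_mx !addr0.
Qed.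

Lemma levi_mx1 n : levi_mx 1%:M = 1%:M :> 'M['F_2]_(n + n).
Proof. by rewrite /levi_mx invmx1 trmx1 -scalar_mx_block. Qed.

(** Transvections generate GL(n, F_2): a nonzero pivot is always 1, so elimination by row additions
    alone reaches the identity. *)
Lemma CNOT_layer n (A : 'M['F_2]_n) : A \in unitmx ->
  exists2 c : circuit n, all (has_kind LC) c & symp c = levi_mx A.
Proof.
pose P B := exists2 c : circuit n, all (has_kind LC) c & symp c = levi_mx B.
(* A transvection is its own inverse, so prepending one CNOT undoes a row addition on [B]. *)
have step B (j k : 'I_n) : j != k -> B \in unitmx ->
    (((1%:M + delta_mx j k) *m B \in unitmx) ->
     P ((1%:M + delta_mx j k) *m B)) -> P B.
  move=> jk uB; rewrite unitmx_mul uB transv_unit // => /(_ isT)[c cC ec].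
  exists (CNOT jk :: c) => //=.
  have uT := transv_unit jk.
  rewrite -/(gate_symp (CNOT jk)) gate_symp_CNOT ec levi_mxM ?unitmx_mul ?uT //.
  by rewrite mulmxA transv_sqr // mul1mx.
have rowE (B : 'M['F_2]_n) (j k i l : 'I_n) :
    ((1%:M + delta_mx j k) *m B) i l = B i l + (i == j)%:R * B k l.
  rewrite mulmxDl mul1mx !mxE; congr (_ + _).
  rewrite (bigD1 k) //= mxE eqxx andbT big1 ?addr0 // => a ak.
  by rewrite mxE (negPf ak) andbF mul0r.
pose std m (B : 'M['F_2]_n) := forall i j : 'I_n, (j < m)%N -> B i j = (i == j)%:R.
(* Gaussian elimination, one column at a time from the left. *)
suff main m : (m <= n)%N ->
    forall B, B \in unitmx -> std (n - m)%N B -> P B.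
  by move=> uA; apply: (main n) => // i j; rewrite subnn.
elim: m => [|m IH] ltmn B uB stB.
  exists [::] => //=; rewrite -levi_mx1; congr levi_mx.
  by apply/matrixP => i j; rewrite mxE stB // subn0.
have lt0 : (n - m.+1 < n)%N by rewrite ltn_subrL (leq_ltn_trans _ ltmn).
pose j0 := Ordinal lt0.
(* With pivot 1, the other ones of column [j0] are removed by adding row [j0], whose entries left of
   the pivot vanish by [std]; [N] bounds their number. *)
have clear N (B' : 'M['F_2]_n) :
    (#|[set i | (i != j0) && (B' i j0 != 0%R)]| < N)%N ->
    B' \in unitmx -> std j0 B' -> B' j0 j0 = 1 -> P B'.
  elim: N B' => [|N IHN] B' // ltN uB' stB' B'1.
  case: (pickP [pred i | (i != j0) && (B' i j0 != 0)]) => /= [i iP | none].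
    have [ij0 nz] := andP iP.
    apply: (step _ i j0) => // uB2; apply: IHN uB2 _ _.
    - move: ltN; rewrite (cardsD1 i) inE iP add1n ltnS; apply: leq_ltn_trans.
      apply/subset_leq_card/subsetP => a; rewrite !inE rowE B'1 mulr1.
      case/andP=> -> /=; have [->|_] := eqVneq a i; last by rewrite addr0 => ->.
      by rewrite (F2_neq0 nz) F2_double eqxx.
    - move=> a b ltb; rewrite rowE !stB' // (_ : (j0 == b) = false) ?mulr0 ?addr0 //.
      by rewrite eq_sym; apply: ltn_eqF.
    - by rewrite rowE eq_sym (negPf ij0) mul0r addr0.
  apply: IH (ltnW ltmn) _ uB' _ => i j.
  rewrite -(subnSK ltmn) ltnS -[(n - _)%N]/(val j0) leq_eqVlt.
  move=> /orP[/eqP/ord_inj ->|/stB' //].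
  have /= := none i; have [-> //|/= _ /negbFE/eqP //] := eqVneq i j0.
have [B1|B0] := eqVneq (B j0 j0) 1; first exact: (clear _ _ (ltnSn _)).
(* A zero pivot is repaired by adding a lower row with a 1 in column [j0]; a higher row would spoil
   one of the columns already reduced. *)
case: (pickP [pred i : 'I_n | (j0 < i)%N && (B i j0 != 0)])
  => /= [i /andP[ji nz] | none].
  have ji' : j0 != i by rewrite neq_ltn ji.
  apply: (step _ j0 i) => // uB2; apply: (clear _ _ (ltnSn _) uB2) => [a b ltb|].
    rewrite rowE !stB // (_ : (i == b) = false) ?mulr0 ?addr0 //.
    by apply/eqP => ib; move: ltb; rewrite -ib ltnNge (ltnW ji).
  rewrite rowE eqxx mul1r (F2_neq0 nz).
  have [->|/F2_neq0 B1] := eqVneq (B j0 j0) 0; first by rewrite add0r.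
  by rewrite B1 eqxx in B0.
(* With no 1 at or below the pivot, column [j0] is a combination of the unit columns to its left;
   [v] is this linear dependency and contradicts invertibility. *)
pose v := \col_l (if (l < j0)%N then B l j0 else (l == j0)%:R).
suff Bv : B *m v = 0.
  have: v j0 ord0 = 0 by rewrite -(mulKmx uB v) Bv mulmx0 mxE.
  by rewrite mxE ltnn eqxx => /eqP; rewrite oner_eq0.
have B00 : B j0 j0 = 0 by apply: contraNeq B0 => /F2_neq0 ->.
apply/colP => i; rewrite !mxE (bigD1 j0) //= mxE ltnn eqxx mulr1.
have [ij|ji] := ltnP i j0.
  rewrite (bigD1 i) /=; last by rewrite neq_ltn ij.
  rewrite (stB i i) // eqxx mul1r mxE ij big1 => [|k /andP[kj ki]].
    by rewrite addr0 F2_double.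
  rewrite mxE; case: ltnP => [kj0|]; last by rewrite (negPf kj) mulr0.
  by rewrite stB // eq_sym (negPf ki) mul0r.
rewrite big1 => [|k kj].
  rewrite addr0; have /= := none i; rewrite leq_eqVlt in ji.
  by case/orP: ji => [/eqP/ord_inj <- //|-> /= /negbFE/eqP].
rewrite mxE; case: ltnP => [kj0|]; last by rewrite (negPf kj) mulr0.
rewrite stB // (_ : (i == k) = false) ?mul0r //.
by apply/eqP => ik; move: kj0; rewrite -ik ltnNge ji.
Qed.

Lemma diag_mx_F2 n (d : 'rV['F_2]_n) :
  diag_mx d = \sum_(i <- enum [pred i | d 0 i != 0]) delta_mx i i.
Proof.
rewrite diag_mx_sum_delta big_enum [RHS]big_mkcond; apply: eq_bigr => i _.
by rewrite inE; have [->|/F2_neq0 ->] := eqVneq; rewrite ?scale0r ?scale1r.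
Qed.

Lemma Phase_layer n (d : 'rV['F_2]_n) :
  exists2 c : circuit n, all (has_kind LP) c & symp c = shear_mx (diag_mx d).
Proof.
rewrite diag_mx_F2; elim: (enum _) => [|i s [c cP ec]].
  by exists [::] => //=; rewrite big_nil /shear_mx -scalar_mx_block.
exists (Phase i :: c) => //=; rewrite ec big_cons -shear_mxD.
have [_ -> _] := delta_mx_block n n n n.
by rewrite scalar_mx_block add_block_mx !addr0 add0r.
Qed.

Lemma gate_symp_Hadamard n (k : 'I_n) :
  gate_symp (Hadamard k) = had_mx (delta_mx k k).
Proof.
have e a b : ((a == b)%:R + ((a == k) && (b == k))%:R : 'F_2)
    = ((a == b) && (a != k))%:R.
  have [<-|ab] := eqVneq a b.
    by rewrite andbb; case: eqVneq; rewrite ?addr0 // F2_double.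
  by have [ak|] := eqVneq a k; rewrite -?ak 1?[b == a]eq_sym ?(negPf ab) addr0.
apply/matrixP => a b; rewrite /gate_symp mxE.
have [a' ->|a' ->] := split_ordP a; have [b' ->|b' ->] := split_ordP b;
  rewrite ?block_mxEul ?block_mxEur ?block_mxEdl ?block_mxEdr !mxE ?e.
all: rewrite permE /= !eq_shift.
all: by have [ak|] := eqVneq a' k; rewrite ?eq_shift ?ak ?andbT ?andbF // eq_sym.
Qed.

Lemma Hadamard_layer n (d : 'rV['F_2]_n) :
  exists2 c : circuit n, all (has_kind LH) c & symp c = had_mx (diag_mx d).
Proof.
rewrite diag_mx_F2; elim: (enum _) => [|i s [c cP ec]].
  by exists [::] => //=; rewrite big_nil /had_mx addr0 -scalar_mx_block.
exists (Hadamard i :: c) => //=.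
by rewrite -/(gate_symp (Hadamard i)) ec big_cons -had_mxD gate_symp_Hadamard.
Qed.

(* Cholesky factorisation; since the diagonal of M is free, the pivots can all be
   taken to be 1. *)
Lemma sym_diag_gram n (M : 'M['F_2]_n) : M^T = M ->
  exists N d, N \in unitmx /\ M = diag_mx d + N *m N^T.
Proof.
elim: n M => [|n IH] M symM.
  by exists 1%:M, 0; split; [exact: unitmx1 | apply/matrixP => -[]].
move: M symM; rewrite -[n.+1]/(1 + n)%N => M.
rewrite -[M]submxK; move: (ulsubmx M) (ursubmx M) (dlsubmx M) (drsubmx M).
move=> a b b' M'; rewrite tr_block_mx => /eq_block_mx[_ _ eb symM'].
(* [M' + b^T *m b] is the Schur complement of a corner pivot 1, minus being plus over F_2; the
   diagonal entry [a 0 0 + 1] below turns the actual corner into that pivot. *)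
have [|N [d [uN eM]]] := IH (M' + b^T *m b).
  by rewrite linearD /= symM' trmx_mul trmxK.
exists (block_mx 1%:M 0 b^T N), (row_mx (const_mx (a 0 0 + 1)) d); split.
  by rewrite unitmxE det_lblock det1 mul1r.
rewrite tr_block_mx mulmx_block !trmx1 trmxK !trmx0 !mul0mx !mulmx0 !mulmx1.
rewrite !mul1mx !addr0 diag_mx_row add_block_mx !add0r eb.
congr block_mx.
  by apply/matrixP => i j; rewrite !ord1 !mxE eqxx -addrA F2_double addr0.
by rewrite addrCA -eM eb addrCA F2_addmxx addr0.
Qed.

(** * Four-layer circuits for the Siegel parabolic subgroup *)

Lemma layered_cat n w1 w2 (c1 c2 : circuit n) :
  layered w1 c1 -> layered w2 c2 -> layered (w1 ++ w2) (c1 ++ c2).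
Proof.
elim: w1 c1 => [|t w1 IH] c1 /=; first by move->.
by case=> [a [b [-> ta lb]]] l2; exists a, (b ++ c2); rewrite catA; split; auto.
Qed.

Lemma layered1 n t (c : circuit n) : all (has_kind t) c -> layered [:: t] c.
Proof. by exists c, [::]; rewrite cats0. Qed.

(** Levi factors normalise the shears, acting on them by congruence. *)
Lemma mul_levi_shear n (A S : 'M['F_2]_n) : A \in unitmx ->
  levi_mx A *m shear_mx S = shear_mx (A *m S *m A^T) *m levi_mx A.
Proof.
move=> uA; rewrite !mulmx_block !mul0mx !mulmx0 !mul1mx !mulmx1 !addr0 !add0r.
by rewrite -mulmxA -trmx_mul mulVmx // trmx1 mulmx1.
Qed.

(** Write [S] as [diag_mx d + N *m N^T]. The diagonal part is a Phase layer; the rest is a Phase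
    gate on every qubit, conjugated by the CNOT layer of [N], whose inverse merges with [A] into the
    last layer. *)
Lemma shear_levi_layers n (S A : 'M['F_2]_n) : S^T = S -> A \in unitmx ->
  exists2 c : circuit n, layered [:: LP; LC; LP; LC] c
    & symp c = shear_mx S *m levi_mx A.
Proof.
move=> /sym_diag_gram[N [d [uN ->]]] uA.
have uN' : invmx N \in unitmx by rewrite unitmx_inv.
have [c1 k1 e1] := Phase_layer d.
have [c2 k2 e2] := CNOT_layer uN.
have [c3 k3 e3] := Phase_layer (const_mx 1 : 'rV_n).
have uNA : invmx N *m A \in unitmx by rewrite unitmx_mul uN'.
have [c4 k4 e4] := CNOT_layer uNA.
exists (c1 ++ (c2 ++ (c3 ++ c4))).
  by do 3 apply: (layered_cat (w1 := [:: _]) (layered1 _)) => //; apply: layered1.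
rewrite !symp_cat e1 e2 e3 e4 diag_const_mx (mulmxA (levi_mx N)) mul_levi_shear //.
by rewrite -mulmxA levi_mxM // mulKVmx // mulmxA shear_mxD mulmx1.
Qed.

(** Mirror image of [shear_levi_layers]: [A] merges with [N] in the first layer, and the diagonal
    Phase layer comes last. *)
Lemma levi_shear_layers n (S A : 'M['F_2]_n) : S^T = S -> A \in unitmx ->
  exists2 c : circuit n, layered [:: LC; LP; LC; LP] c
    & symp c = levi_mx A *m shear_mx S.
Proof.
move=> /sym_diag_gram[N [d [uN ->]]] uA.
have uN' : invmx N \in unitmx by rewrite unitmx_inv.
have uAN : A *m N \in unitmx by rewrite unitmx_mul uA.
have [c1 k1 e1] := CNOT_layer uAN.
have [c2 k2 e2] := Phase_layer (const_mx 1 : 'rV_n).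
have [c3 k3 e3] := CNOT_layer uN'.
have [c4 k4 e4] := Phase_layer d.
exists (c1 ++ (c2 ++ (c3 ++ c4))).
  by do 3 apply: (layered_cat (w1 := [:: _]) (layered1 _)) => //; apply: layered1.
rewrite !symp_cat e1 e2 e3 e4 diag_const_mx -levi_mxM // -!mulmxA; congr (_ *m _).
rewrite (mulmxA (levi_mx N)) mul_levi_shear // mulmx1 -mulmxA.
rewrite (mulmxA (levi_mx N)) levi_mxM //.
by rewrite mulmxV // levi_mx1 mul1mx shear_mxD addrC.
Qed.

(** * The symplectic group and its Bruhat decomposition *)

Definition preserves_J n (M : 'M['F_2]_(n + n)) := M^T *m Jmx n *m M = Jmx n.

Lemma sp_block n (A B C D : 'M['F_2]_n) :
  preserves_J (block_mx A B C D) <->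
  [/\ C^T *m A + A^T *m C = 0, C^T *m B + A^T *m D = 1%:M,
      D^T *m A + B^T *m C = 1%:M & D^T *m B + B^T *m D = 0].
Proof.
rewrite /preserves_J /Jmx tr_block_mx !mulmx_block !mulmx0 !mulmx1 !add0r !addr0.
by split=> [/eq_block_mx //|[-> -> -> ->]].
Qed.

Lemma spM n (M N : 'M['F_2]_(n + n)) :
  preserves_J M -> preserves_J N -> preserves_J (M *m N).
Proof.
move=> sM sN; rewrite /preserves_J trmx_mul -!mulmxA (mulmxA (Jmx n)).
by rewrite !(mulmxA M^T) sM mulmxA.
Qed.

Lemma Jmx_sqr n : Jmx n *m Jmx n = 1%:M.
Proof.
by rewrite mulmx_block !mulmx0 !mul0mx !mulmx1 !addr0 !add0r -scalar_mx_block.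
Qed.

Lemma sp_mulVJ n (M : 'M['F_2]_(n + n)) : preserves_J M ->
  (Jmx n *m M^T *m Jmx n) *m M = 1%:M.
Proof. by move=> sM; rewrite -!mulmxA (mulmxA M^T) sM Jmx_sqr. Qed.

(** The left inverse J M^T J of [M] is also a right inverse, which is the relation for [M^T]. *)
Lemma sp_tr n (M : 'M['F_2]_(n + n)) : preserves_J M -> preserves_J M^T.
Proof.
move=> /sp_mulVJ/mulmx1C; rewrite /preserves_J trmxK => e.
by rewrite -[RHS]mul1mx -e -!mulmxA Jmx_sqr mulmx1.
Qed.

Lemma sp_Sp n (M : 'M['F_2]_(n + n)) : preserves_J M -> M \in Sp n.
Proof.
by move=> sM; rewrite inE sM eqxx andbT; have [] := mulmx1_unit (sp_mulVJ sM).
Qed.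

Lemma sp_shear n (S : 'M['F_2]_n) : S^T = S -> preserves_J (shear_mx S).
Proof.
move=> sS; apply/sp_block; rewrite !trmx0 !trmx1 !mul0mx !mulmx0 !mulmx1 !mul1mx.
by rewrite sS !addr0 add0r F2_addmxx.
Qed.

Lemma sp_levi n (A : 'M['F_2]_n) : A \in unitmx -> preserves_J (levi_mx A).
Proof.
move=> uA; apply/sp_block; rewrite !trmx0 trmxK !mul0mx !mulmx0 !addr0 !add0r.
by rewrite mulVmx // -trmx_mul mulVmx // trmx1.
Qed.

Lemma sp_had n (D : 'M['F_2]_n) : D^T = D -> preserves_J (had_mx D).
Proof.
move=> sD; have sD1 : (1%:M + D)^T = 1%:M + D by rewrite linearD /= trmx1 sD.
apply/sp_block; rewrite sD1 sD !mulmxDl !mulmxDr !mul1mx !mulmx1 F2_addmxx.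
have e : D *m D + (1%:M + D + (D + D *m D)) = 1%:M.
  by rewrite -addrA F2_addmxK addrCA F2_addmxx addr0.
by rewrite e addrC e.
Qed.

Lemma sp_gate n (g : gate n) : preserves_J (gate_symp g).
Proof.
case: g => [k|k|j k jk].
- by rewrite gate_symp_Hadamard; apply: sp_had; rewrite trmx_delta.
- have -> : gate_symp (Phase k) = shear_mx (delta_mx k k).
    rewrite /gate_symp; have [_ -> _] := delta_mx_block n n n n.
    by rewrite scalar_mx_block add_block_mx !addr0 add0r.
  by apply: sp_shear; rewrite trmx_delta.
- by rewrite gate_symp_CNOT; apply/sp_levi/transv_unit.
Qed.

Lemma sp_symp n (c : circuit n) : preserves_J (symp c).
Proof.
elim: c => [|g c IH] /=; last exact: spM (sp_gate g) IH.
by rewrite /preserves_J trmx1 mul1mx mulmx1.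
Qed.

(** The relation A^T D = 1 forces D to be the transposed inverse of A, and the relations for the
    transpose make the witness [B *m A^T] symmetric. *)
Lemma sp_upper n (A B D : 'M['F_2]_n) : preserves_J (block_mx A B 0 D) ->
  exists S, [/\ S^T = S, A \in unitmx & block_mx A B 0 D = shear_mx S *m levi_mx A].
Proof.
move=> sM; have := sp_tr sM; rewrite tr_block_mx => /sp_block[].
rewrite !trmxK => symB _ _ _.
have /sp_block[_ e _ _] := sM; rewrite trmx0 mul0mx add0r in e.
have uA : A \in unitmx by have [] := mulmx1_unit e; rewrite unitmx_tr.
exists (B *m A^T); split=> //.
  rewrite trmx_mul trmxK; apply/eqP; rewrite -subr_eq0 F2_oppmx addrC.
  by rewrite symB.
rewrite mulmx_block !mul0mx !mulmx0 !mul1mx !addr0 !add0r -mulmxA -trmx_mul.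
rewrite mulVmx // trmx1 mulmx1; congr block_mx.
have uA' : A^T \in unitmx by rewrite unitmx_tr.
by apply: (can_inj (mulKmx uA')); rewrite e -trmx_mul mulVmx ?trmx1.
Qed.

(** Rank normal form; applied to the lower left block, [E] selects the qubits that receive a
    Hadamard gate. *)
Lemma diag_rank_form n (A : 'M['F_2]_n) : exists X Y E : 'M['F_2]_n,
  [/\ X \in unitmx, Y \in unitmx, exists d, E = diag_mx d, E *m E = E
    & A = X *m E *m Y].
Proof.
exists (col_ebase A), (row_ebase A), (pid_mx (\rank A)).
split; rewrite ?col_ebase_unit ?row_ebase_unit ?pid_mx_id ?rank_leq_row //.
  exists (\row_i (i < \rank A)%:R); apply/matrixP => i j.
  by rewrite !mxE -val_eqE /=; case: eqP.
by rewrite mulmx_ebase.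
Qed.

Lemma sp_layers n (M : 'M['F_2]_(n + n)) : preserves_J M -> exists d : circuit n,
  layered [:: LP; LC; LP; LC; LH; LC; LP; LC; LP] d /\ symp d = M.
Proof.
rewrite -[M]submxK; move: (ulsubmx M) (ursubmx M) (dlsubmx M) (drsubmx M).
move=> A B C D sM.
have [X [Y [E [uX uY [d eE] EE eC]]]] := diag_rank_form C.
have symE : E^T = E by rewrite eE tr_diag_mx.
(* [D1] is the block [D] in the coordinates where [C] becomes [E]; the symplectic relation D C^T = C
   D^T then says that [D1 *m E] is symmetric. *)
pose D1 := invmx X *m D *m Y^T.
have symD1 : (D1 *m E)^T = D1 *m E.
  have /sp_tr := sM; rewrite tr_block_mx => /sp_block[_ _ _].
  rewrite !trmxK eC !trmx_mul symE => /eqP; rewrite addr_eq0 F2_oppmx => /eqP e.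
  apply: (can_inj (mulKmx uX)); have uX' : X^T \in unitmx by rewrite unitmx_tr.
  apply: (can_inj (mulmxK uX')).
  rewrite !mulmxA in e; rewrite /D1 trmxK !mulmxA mulmxV // mul1mx e.
  by rewrite trmx_inv mulmxKV.
have uY' : invmx Y \in unitmx by rewrite unitmx_inv.
(* C = X E Y with E diagonal idempotent.  The symmetric matrix D1 E is chosen so
   that the lower left block of q vanishes. *)
pose q := block_mx A B C D *m levi_mx (invmx Y) *m shear_mx (D1 *m E) *m had_mx E.
have : preserves_J q.
  apply: spM (sp_had symE); apply: spM (sp_shear symD1).
  exact: spM (sp_levi uY').
have [A' [B' [D' eq]]] : exists A' B' D', q = block_mx A' B' 0 D'.
  do 3 eexists; rewrite /q !mulmx_block; congr block_mx.
  rewrite !mulmx0 !mulmx1 !addr0 !add0r invmxK eC mulmxK //.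
  have -> : D *m Y^T = X *m D1 by rewrite /D1 !mulmxA mulmxV ?mul1mx.
  have ED1E : E *m (D1 *m E) = D1 *m E.
    by rewrite -symD1 trmx_mul symE mulmxA EE.
  rewrite -(mulmxA X E (D1 *m E)) ED1E mulmxDr mulmx1 mulmxDl.
  rewrite -(mulmxA X E E) EE F2_addmxx add0r.
  by rewrite (mulmxA X) -(mulmxA _ E E) EE F2_addmxx.
rewrite eq => /sp_upper[S1 [symS1 uA']]; rewrite -eq => eq'.
(* The factors of [q] are undone from the right: the shear and [had_mx E] are involutions, and
   moving [levi_mx Y] to the left of the shear replaces [D1 *m E] by a congruent matrix. *)
have eM : block_mx A B C D =
    (shear_mx S1 *m levi_mx A') *m had_mx E *m
    (levi_mx Y *m shear_mx (invmx Y *m (D1 *m E) *m (invmx Y)^T)).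
  rewrite mul_levi_shear // !mulmxA mulmxV // mul1mx -(mulmxA (D1 *m E)).
  rewrite -trmx_mul mulmxV // trmx1 mulmx1 -eq' /q.
  rewrite -(mulmxA _ (had_mx E) (had_mx E)) had_mxD.
  rewrite F2_addmxx /had_mx addr0 -scalar_mx_block mulmx1.
  rewrite -(mulmxA _ (shear_mx _) (shear_mx _)) shear_mxD F2_addmxx /shear_mx.
  rewrite -scalar_mx_block mulmx1.
  by rewrite -mulmxA levi_mxM // mulVmx // levi_mx1 mulmx1.
have [||c1 k1 e1] := @shear_levi_layers n S1 A' => //.
have [c2 k2 e2] := Hadamard_layer d; rewrite -eE in e2.
have [||c3 k3 e3] :=
  @levi_shear_layers n (invmx Y *m (D1 *m E) *m (invmx Y)^T) Y => //.
  by rewrite 2!trmx_mul trmxK symD1 mulmxA.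
exists (c1 ++ (c2 ++ c3)); rewrite !symp_cat e1 e2 e3 eM mulmxA; split=> //.
apply: (layered_cat (w1 := [:: _; _; _; _])) => //.
by apply: (layered_cat (w1 := [:: _])) => //; apply: layered1.
Qed.

(** * Pauli matrices on one qubit *)

Section Unitary.
Variable C : numClosedFieldType.

Lemma mul_mx2 (a b c d a' b' c' d' : C) :
  mx2 a b c d *m mx2 a' b' c' d' =
  mx2 (a * a' + b * c') (a * b' + b * d') (c * a' + d * c') (c * b' + d * d').
Proof.
apply/matrixP => i j; rewrite !mxE !big_ord_recl big_ord0 addr0 !mxE /=.
by case: (i == 0); case: (j == 0).
Qed.

Lemma scale_mx2 (k a b c d : C) :
  k *: mx2 a b c d = mx2 (k * a) (k * b) (k * c) (k * d).
Proof. by apply/matrixP => i j; rewrite !mxE; do 2 case: ifP. Qed.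

Lemma mx2_1 : 1%:M = mx2 1 0 0 1 :> 'M[C]_2.
Proof.
by apply/matrixP => -[[|[|//]] ?] [[|[|//]] ?]; rewrite !mxE.
Qed.

Definition pauli1 (x z : bool) : 'M[C]_2 :=
  (if x then Xmx C else 1%:M) *m (if z then Zmx C else 1%:M).

Lemma pauli1_mx2 x z : pauli1 x z =
  let s := (-1) ^+ z in if x then mx2 0 s 1 0 else mx2 1 0 0 s.
Proof.
rewrite /pauli1 mx2_1; case: x z => [] [] /=; rewrite mul_mx2; congr mx2; ring.
Qed.

Lemma pauli1E x z (i j : 'I_2) : pauli1 x z i j =
  ((i != 0) == (j != 0) (+) x)%:R * (-1) ^+ (z && (j != 0)).
Proof.
rewrite pauli1_mx2; case: i j x z => [[|[|//]] ?] [[|[|//]] ?] [] [];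
  rewrite !mxE /=; ring.
Qed.

Lemma pauli1_sqr x z : pauli1 x z *m pauli1 x z = (-1) ^+ (x && z) *: 1%:M.
Proof.
rewrite pauli1_mx2 mx2_1; case: x z => [] [] /=;
  rewrite mul_mx2 scale_mx2; congr mx2; ring.
Qed.

Lemma pauli1_comm x z x' z' : pauli1 x z *m pauli1 x' z' =
  (-1) ^+ ((x && z') (+) (x' && z)) *: (pauli1 x' z' *m pauli1 x z).
Proof.
rewrite !pauli1_mx2; case: x z x' z' => [] [] [] [] /=;
  rewrite !mul_mx2 scale_mx2; congr mx2; ring.
Qed.

Lemma Hmx_pauli1 x z :
  Hmx C *m pauli1 x z = (-1) ^+ (x && z) *: (pauli1 z x *m Hmx C).
Proof.
rewrite !pauli1_mx2 /Hmx; case: x z => [] [] /=;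
  rewrite -scalemxAl -scalemxAr !mul_mx2 !scale_mx2; congr mx2; ring.
Qed.

Lemma Pmx_pauli1 x z :
  Pmx C *m pauli1 x z = 'i ^+ x *: (pauli1 x (z (+) x) *m Pmx C).
Proof.
have ii := sqrCi C.
rewrite !pauli1_mx2 /Pmx; case: x z => [] [] /=;
  rewrite !mul_mx2 !scale_mx2; congr mx2; ring: ii.
Qed.

Lemma Hmx_sqr : Hmx C *m Hmx C = 1%:M.
Proof.
rewrite /Hmx -scalemxAl -scalemxAr mul_mx2 scalerA scale_mx2 mx2_1.
have -> : (sqrtC 2)^-1 * (sqrtC 2)^-1 = 2^-1 :> C.
  by rewrite -invfM -expr2 sqrtCK.
by congr mx2; field.
Qed.

Lemma Pmx_sqr : Pmx C *m Pmx C = Zmx C.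
Proof. by have ii := sqrCi C; rewrite mul_mx2; congr mx2; ring: ii. Qed.

(** * Conjugation of Pauli operators by circuits *)

Variable n : nat.

Lemma tensorM (U V : 'I_n -> 'M[C]_2) :
  tensor U *m tensor V = tensor (fun l => U l *m V l).
Proof.
apply/matrixP => x y; rewrite !mxE.
under [RHS]eq_bigr do rewrite mxE.
rewrite bigA_distr_bigA [RHS](reindex _ (onW_bij _ (@enum_val_bij (basis n)))) /=.
by apply: eq_bigr => z _; rewrite !mxE -big_split.
Qed.

Lemma tensorZ (a : 'I_n -> C) (U : 'I_n -> 'M[C]_2) :
  tensor (fun l => a l *: U l) = (\prod_l a l) *: tensor U.
Proof.
apply/matrixP => x y; rewrite !mxE -big_split.
by apply: eq_bigr => l _; rewrite mxE.
Qed.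

Lemma eq_tensor (U V : 'I_n -> 'M[C]_2) : U =1 V -> tensor U = tensor V.
Proof.
by move=> UV; apply/matrixP => x y; rewrite !mxE; apply: eq_bigr => l _; rewrite UV.
Qed.

Lemma bits_neqP (x y : 'I_#|{: basis n}|) :
  x != y -> exists l, bits x l != bits y l.
Proof.
move=> xy; apply/existsP; apply: contraR xy; rewrite negb_exists => /forallP xy.
by apply/eqP/enum_val_inj/ffunP => l; have /negPn/eqP := xy l.
Qed.

Lemma tensor1 : tensor (fun=> 1%:M) = 1%:M :> 'Op[C]_n.
Proof.
apply/matrixP => x y; rewrite !mxE; have [->|xy] := eqVneq x y.
  by rewrite big1 // => l _; rewrite mxE eqxx.
have [l bl] := bits_neqP xy.
by rewrite (bigD1 l) //= mxE (negPf bl) mul0r.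
Qed.

(* No phase is attached: the factor of qubit l is X^x Z^z, so that Y appears as
   X Z = - i Y. *)
Definition pauli (v : 'rV['F_2]_(n + n)) : 'Op[C]_n :=
  tensor (fun l => pauli1 (v 0 (lshift n l) != 0) (v 0 (rshift n l) != 0)).

(** Conjugation written without an inverse; the scalar [a] absorbs the phase that the encoding by
    [v] forgets. *)
Definition acts_as (U : 'Op[C]_n) (S : 'M['F_2]_(n + n)) := forall v,
  exists2 a, a != 0 & U *m pauli v = a *: (pauli (v *m S) *m U).

Lemma on_qubitM k (U V : 'M[C]_2) :
  on_qubit k U *m on_qubit k V = on_qubit k (U *m V) :> 'Op[C]_n.
Proof.
by rewrite /on_qubit tensorM; apply: eq_tensor => l;
  case: eqP => // _; rewrite mulmx1.
Qed.

Lemma on_qubit_pauli k (U : 'M[C]_2) (a : C) (v w : 'rV['F_2]_(n + n)) :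
  (forall l, l != k -> w 0 (lshift n l) = v 0 (lshift n l) /\
                       w 0 (rshift n l) = v 0 (rshift n l)) ->
  U *m pauli1 (v 0 (lshift n k) != 0) (v 0 (rshift n k) != 0) =
    a *: (pauli1 (w 0 (lshift n k) != 0) (w 0 (rshift n k) != 0) *m U) ->
  on_qubit k U *m pauli v = a *: (pauli w *m on_qubit k U).
Proof.
move=> vw Uk; rewrite /on_qubit !tensorM.
have -> : a = \prod_l (if l == k then a else 1) by rewrite -big_mkcond big_pred1_eq.
rewrite -tensorZ; apply: eq_tensor => l; have [->//|lk] := eqVneq l k.
by have [-> ->] := vw l lk; rewrite mulmx1 mul1mx scale1r.
Qed.

Lemma F2_nat_neq0 (b : bool) : (b%:R != 0 :> 'F_2) = b.
Proof. by case: b. Qed.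

Lemma F2_addb (a b : 'F_2) : (a + b != 0) = (a != 0) (+) (b != 0).
Proof. by case: a b => [[|[|//]] ?] [[|[|//]] ?]. Qed.

Lemma I2_addb (a b : 'I_2) : (a + b != 0) = (a != 0) (+) (b != 0).
Proof. exact: F2_addb. Qed.

Lemma mul_row_delta m p (v : 'rV['F_2]_m) i (j a : 'I_p) :
  (v *m delta_mx i j) 0 a = (a == j)%:R * v 0 i.
Proof.
rewrite mxE (bigD1 i) //= mxE eqxx mulrC big1 ?addr0 // => b bi.
by rewrite mxE (negPf bi) mulr0.
Qed.

Lemma cnotK (j k : 'I_n) : j != k -> involutive (cnot j k).
Proof.
move=> jk b; apply/ffunP => l; rewrite !ffunE (negPf jk) eqxx.
case: eqP => [->|//]; case: (b j) (b k) => [[|[|//]] ?] [[|[|//]] ?]; exact: val_inj.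
Qed.

(** [CNOTmx] is a permutation matrix, so on each side the sum over intermediate basis states has a
    single nonzero term. *)
Lemma CNOT_pauli (j k : 'I_n) (v w : 'rV['F_2]_(n + n)) : j != k ->
  (forall l, w 0 (lshift n l)
     = v 0 (lshift n l) + (l == k)%:R * v 0 (lshift n j)) ->
  (forall l, w 0 (rshift n l)
     = v 0 (rshift n l) + (l == j)%:R * v 0 (rshift n k)) ->
  CNOTmx C j k *m pauli v = pauli w *m CNOTmx C j k.
Proof.
move=> jk wx wz; apply/matrixP => x y; rewrite !mxE.
have cE a b : (a == cnot j k b) = (b == cnot j k a).
  by rewrite -(inj_eq (inv_inj (cnotK jk))) (cnotK jk) eq_sym.
rewrite (bigD1 (enum_rank (cnot j k (bits x)))) //= big1 => [|z]; last first.
  rewrite !mxE cE => zx; case: eqP => [zx'|]; last by rewrite mul0r.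
  by case/eqP: zx; rewrite -zx' enum_valK.
rewrite [RHS](bigD1 (enum_rank (cnot j k (bits y)))) //= big1 => [|z]; last first.
  rewrite !mxE => zx; case: eqP => [zx'|]; last by rewrite mulr0.
  by case/eqP: zx; rewrite -zx' enum_valK.
rewrite !mxE /bits !enum_rankK -/(bits x) -/(bits y) cE !eqxx mul1r mulr1 !addr0.
(* Only the factors of qubits [j] and [k] interact; their product is compared over all values of the
   eight bits involved. *)
rewrite (bigD1 j) // (bigD1 k) 1?eq_sym //=.
rewrite [RHS](bigD1 j) // [in RHS](bigD1 k) 1?eq_sym //=.
rewrite !mulrA; congr (_ * _).
  rewrite !pauli1E !wx !wz !ffunE !eqxx [k == j]eq_sym (negPf jk).
  rewrite !mul1r !mul0r !addr0.
  rewrite !F2_addb; move: (bits x j != 0) (bits x k != 0) (bits y j != 0)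
    (bits y k != 0) (v 0 (lshift n j) != 0) (v 0 (lshift n k) != 0)
    (v 0 (rshift n j) != 0) (v 0 (rshift n k) != 0).
  by do 8 case; rewrite /= ?mul0r ?mulr0 ?mul1r ?mulr1 ?mulrNN ?mulr1.
apply: eq_bigr => l /andP[lj lk].
by rewrite wx wz !ffunE (negPf lj) (negPf lk) !mul0r !addr0.
Qed.

Lemma acts_as_gate (g : gate n) :
  acts_as (gate_unitary C g) (gate_symp g).
Proof.
case: g => [k|k|j k jk] v /=.
- have e a : (v *m tperm_mx (lshift n k) (rshift n k)) 0 a
      = v 0 (tperm (lshift n k) (rshift n k) a) by rewrite -xcolE mxE.
  exists ((-1) ^+ ((v 0 (lshift n k) != 0) && (v 0 (rshift n k) != 0)));
    first by rewrite signr_eq0.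
  apply: on_qubit_pauli => [l lk|]; last by rewrite !e tpermL tpermR Hmx_pauli1.
  by rewrite !e !tpermD // ?eq_shift // eq_sym.
- have e a : (v *m (1%:M + delta_mx (lshift n k) (rshift n k))) 0 a
      = v 0 a + (a == rshift n k)%:R * v 0 (lshift n k).
    by rewrite mulmxDr mulmx1 mxE mul_row_delta.
  exists ('i ^+ (v 0 (lshift n k) != 0)); first by rewrite expf_neq0 ?neq0Ci.
  apply: on_qubit_pauli => [l lk|];
    rewrite !e !eq_shift ?(negPf lk) !mul0r !addr0 //.
  by rewrite eqxx mul1r F2_addb Pmx_pauli1.
- have e a : (v *m (1%:M + delta_mx (lshift n j) (lshift n k)
                      + delta_mx (rshift n k) (rshift n j))) 0 a
      = v 0 a + (a == lshift n k)%:R * v 0 (lshift n j)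
              + (a == rshift n j)%:R * v 0 (rshift n k).
    by rewrite !mulmxDr mulmx1 mxE [X in X + _]mxE !mul_row_delta.
  exists 1; rewrite ?oner_neq0 // scale1r.
  by apply: CNOT_pauli => // l; rewrite e !eq_shift mul0r addr0.
Qed.

Lemma acts_as_symp (c : circuit n) : acts_as (unitary C c) (symp c).
Proof.
elim: c => [|g c IH] v /=.
  by exists 1; rewrite ?oner_neq0 // mulmx1 mul1mx mulmx1 scale1r.
have [a a0 ea] := acts_as_gate g v.
have [b b0 eb] := IH (v *m gate_symp g).
exists (a * b); first by rewrite mulf_neq0.
rewrite -mulmxA ea -scalemxAr (mulmxA (unitary C c)) eb.
by rewrite -scalemxAl scalerA !mulmxA.
Qed.

(** * Recovering a unitary from its symplectic matrix, up to phase and Pauli operators *)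

Lemma pauli_sqr v : exists b : bool, pauli v *m pauli v = (-1) ^+ b *: 1%:M.
Proof.
rewrite /pauli tensorM (eq_tensor (fun l => pauli1_sqr _ _)) tensorZ tensor1.
elim/big_rec: _ => [|l a _ [b eb]]; first by exists false; rewrite expr0.
move: (_ && _) => s; exists (s (+) b).
by rewrite signr_addb -[LHS]scalerA eb scalerA.
Qed.

(** The commutation sign is the symplectic form of the two vectors, so a basis vector reads off the
    conjugate coordinate of [v]. Any signs on the basis can thus be realised by a suitable [v]. *)
Lemma pauli_comm_delta v (l : 'I_n) :
  (let e := delta_mx 0 (lshift n l) in pauli v *m pauli e =
    (-1) ^+ (v 0 (rshift n l) != 0%R) *: (pauli e *m pauli v)) /\
  (let e := delta_mx 0 (rshift n l) in pauli v *m pauli e =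
    (-1) ^+ (v 0 (lshift n l) != 0%R) *: (pauli e *m pauli v)).
Proof.
split=> /=; rewrite /pauli !tensorM (eq_tensor (fun l => pauli1_comm _ _ _ _));
  rewrite tensorZ; congr (_ *: _); rewrite (bigD1 l) //= big1 => [|l' l'l];
  rewrite !mxE !eq_shift ?eqxx ?(negPf l'l) !F2_nat_neq0 ?mulr1.
all: by rewrite /= ?andbT ?andbF ?addbF.
Qed.

Lemma norm_det_sqr m (M : 'M[C]_m) : `|\det (M *m M)| = 1 -> `|\det M| = 1.
Proof.
rewrite det_mulmx normrM -expr2 => /eqP.
by rewrite sqrp_eq1 ?normr_ge0 // => /eqP.
Qed.

(* Gates have finite order, hence determinants of modulus 1; this bounds the
   global phase without using adjoints. *)
Lemma norm_det_unitary (c : circuit n) : `|\det (unitary C c)| = 1.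
Proof.
elim: c => [|g c IH] /=; first by rewrite det1 normr1.
rewrite det_mulmx normrM IH mul1r {c IH}; case: g => [k|k|j k jk] /=.
- apply: norm_det_sqr; rewrite on_qubitM Hmx_sqr.
  rewrite /on_qubit (eq_tensor (V := fun=> 1%:M)); last by move=> l; case: ifP.
  by rewrite tensor1 det1 normr1.
- apply/norm_det_sqr/norm_det_sqr; rewrite !on_qubitM Pmx_sqr.
  have -> : Zmx C *m Zmx C = 1%:M by rewrite mul_mx2 mx2_1; congr mx2; ring.
  rewrite /on_qubit (eq_tensor (V := fun=> 1%:M)); last by move=> l; case: ifP.
  by rewrite tensor1 det1 normr1.
- apply: norm_det_sqr; have -> : CNOTmx C j k *m CNOTmx C j k = 1%:M.
    apply/matrixP => x y; rewrite !mxE.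
    rewrite (bigD1 (enum_rank (cnot j k (bits y)))) //= big1 => [|z zy]; last first.
      rewrite !mxE [bits z == _](introF eqP) ?mulr0 // => zy'.
      by case/eqP: zy; rewrite -zy' enum_valK.
    rewrite !mxE /bits enum_rankK eqxx mulr1 addr0 cnotK //.
    by rewrite (inj_eq enum_val_inj).
  by rewrite det1 normr1.
Qed.

Lemma I2_neq0_inj : injective (fun a : 'I_2 => a != 0).
Proof. by move=> [[|[|//]] ?] [[|[|//]] ?] // _; apply: val_inj. Qed.

(** The permutation underlying the monomial matrix [pauli v]: bits are flipped by its X part. *)
Definition shift (v : 'rV['F_2]_(n + n)) (b : basis n) : basis n :=
  [ffun l => b l + (v 0 (lshift n l) != 0)%:R].

Lemma pauliE v x y : pauli v x y = (bits x == shift v (bits y))%:R *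
  \prod_l (-1) ^+ ((v 0 (rshift n l) != 0) && (bits y l != 0)).
Proof.
rewrite mxE; under [LHS]eq_bigr do rewrite pauli1E.
rewrite big_split; congr (_ * _).
have shiftE l : (shift v (bits y) l != 0) =
    (bits y l != 0) (+) (v 0 (lshift n l) != 0).
  by rewrite ffunE I2_addb; congr (_ (+) _); case: (v 0 _ != 0).
under [X in X = _]eq_bigr do rewrite -shiftE.
have [->|xy] := eqVneq; first by rewrite big1 // => l _; rewrite eqxx.
have /existsP[l bl] : [exists l, bits x l != shift v (bits y) l].
  apply: contraR xy; rewrite negb_exists => /forallP xy.
  by apply/eqP/ffunP => l; have /negPn/eqP := xy l.
by rewrite (bigD1 l) //= (inj_eq I2_neq0_inj) (negPf bl) mul0r.
Qed.

Lemma shiftK v : involutive (shift v).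
Proof.
move=> b; apply/ffunP => l; rewrite !ffunE; case: (_ != 0).
  by case: (b l) => [[|[|//]] ?]; apply: val_inj.
by rewrite !addr0.
Qed.

(* Commuting with the Z_l makes K diagonal, and then commuting with the X_l makes
   its diagonal invariant under bit flips. *)
Lemma commute_basis_scalar (K : 'Op[C]_n) :
  (forall i, K *m pauli (delta_mx 0 i) = pauli (delta_mx 0 i) *m K) ->
  exists k, K = k%:M.
Proof.
move=> comm.
have K0 x y : x != y -> K x y = 0.
  move=> /bits_neqP[l bl].
  have Zdiag : pauli (delta_mx 0 (rshift n l)) =
      diag_mx (\row_z (-1) ^+ (bits z l != 0)).
    apply/matrixP => a b; rewrite pauliE.
    have -> : shift (delta_mx 0 (rshift n l)) (bits b) = bits b.
      by apply/ffunP => l'; rewrite ffunE mxE !eq_shift F2_nat_neq0 andbF addr0.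
    rewrite (bigD1 l) //= big1 => [|l' l'l].
      rewrite !mxE (inj_eq enum_val_inj) !eqxx /= mulr1.
      by have [->|_] := eqVneq a b; rewrite ?mul1r ?mul0r.
    by rewrite mxE !eq_shift (negPf l'l) andbF.
  (* Z_l has opposite eigenvalues on [x] and [y], which differ in bit [l], so the commutation reads
     K x y = - K x y. *)
  have := comm (rshift n l); rewrite Zdiag mul_mx_diag mul_diag_mx.
  move=> /matrixP/(_ x y); rewrite !mxE; move: bl; rewrite -(inj_eq I2_neq0_inj).
  case: (bits x l != 0); case: (bits y l != 0) => //= _.
    by rewrite mulr1 mulN1r => /esym/eqP; rewrite eqNr => /eqP.
  by rewrite mulrN1 mul1r => /eqP; rewrite eqNr => /eqP.
pose k b := K (enum_rank b) (enum_rank b).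
have k_shift l b : k (shift (delta_mx 0 (lshift n l)) b) = k b.
  set v := delta_mx _ _; have XE x y : pauli v x y = (bits x == shift v (bits y))%:R.
    by rewrite pauliE big1 ?mulr1 // => l' _; rewrite mxE !eq_shift andbF.
  have := comm (lshift n l); move/matrixP/(_ (enum_rank (shift v b)) (enum_rank b)).
  rewrite !mxE (bigD1 (enum_rank (shift v b))) //= big1 => [|y yb]; last first.
    rewrite XE /bits enum_rankK (introF eqP) ?mulr0 // => yb'.
    by case/eqP: yb; rewrite -yb' enum_valK.
  rewrite XE /bits !enum_rankK eqxx mulr1 addr0 -/(k _) => ->.
  rewrite (bigD1 (enum_rank b)) //= big1 => [|y yb]; last first.
    rewrite XE /bits !enum_rankK (inj_eq (can_inj (shiftK v))).
    rewrite (introF eqP) ?mul0r // => yb'.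
    by case/eqP: yb; rewrite yb' enum_valK.
  by rewrite XE /bits !enum_rankK eqxx mul1r addr0.
(* Induction on the number of ones in [b]: flipping one of them to 0 keeps [k b]. *)
have k_const m (b : basis n) : (#|[set l | b l != 0%R]| < m)%N -> k b = k [ffun=> 0].
  elim: m b => // m IH b ltm; case: (pickP [pred l | b l != 0]) => /= [l bl|b0].
    rewrite -(k_shift l); apply: IH; move: ltm.
    rewrite (cardsD1 l) inE bl add1n ltnS; apply: leq_ltn_trans.
    apply/subset_leq_card/subsetP => l'; rewrite !inE ffunE mxE eq_shift F2_nat_neq0.
    have [->|_] := eqVneq l' l; last by rewrite addr0.
    by rewrite I2_addb bl.
  by congr k; apply/ffunP => l; rewrite ffunE; apply/eqP/negbFE/b0.
exists (k [ffun=> 0]); apply/matrixP => x y; rewrite mxE.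
have [<-|/K0 //] := eqVneq x y.
by rewrite -(k_const _ (bits x) (ltnSn _)) /k /bits enum_valK.
Qed.

Lemma pauli_is_pauli (v : 'rV['F_2]_(n + n)) : exists2 a : C, `|a| = 1 &
  exists2 Q, is_pauli Q & pauli v = a *: Q.
Proof.
pose x l := v 0 (lshift n l) != 0; pose z l := v 0 (rshift n l) != 0.
pose p l := if x l then if z l then Ymx C else Xmx C
            else if z l then Zmx C else 1%:M.
exists (\prod_l (if x l && z l then - 'i else 1)).
  rewrite normr_prod big1 // => l _.
  by case: ifP; rewrite ?normrN ?normCi ?normr1.
exists (tensor p).
  by exists p => // k; rewrite /p !inE; do 2 case: ifP; rewrite eqxx ?orbT.
rewrite -tensorZ; apply: eq_tensor => l; rewrite -/(x l) -/(z l) /p /pauli1.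
case: (x l) (z l) => [] [] /=; rewrite ?scale1r ?mul1mx ?mulmx1 //.
have ii := sqrCi C.
by rewrite mul_mx2 scale_mx2; congr mx2; ring: ii.
Qed.

Lemma eq_symp_unitary (c d : circuit n) : symp c = symp d ->
  eq_mod_phase_pauli (unitary C c) (unitary C d).
Proof.
move=> cd; pose x0 : 'I_#|{: basis n}| := enum_rank [ffun=> 0].
have norm1_unit (U : 'Op[C]_n) : `|\det U| = 1 -> U \in unitmx.
  by rewrite unitmxE unitfE => U1; rewrite -normr_eq0 U1 oner_eq0.
have [nc nd] := (norm_det_unitary c, norm_det_unitary d).
have ud := norm1_unit _ nd.
have := sp_Sp (sp_symp c); rewrite inE => /andP[uS _].
pose K := unitary C c *m invmx (unitary C d).
have eK : K *m unitary C d = unitary C c by rewrite mulmxKV.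
clearbody K.
have nK : `|\det K| = 1.
  by have := congr1 (fun U => `|\det U|) eK; rewrite det_mulmx normrM nd mulr1 nc.
have uK := norm1_unit _ nK.
(* The commutation factor [a / b] is at first any nonzero scalar. Since [pauli v] squares to a sign,
   moving [K] past it twice shows that the factor squares to 1. *)
have sgnK v : exists b : bool, K *m pauli v = (-1) ^+ b *: (pauli v *m K).
  have [a a0 ea] := acts_as_symp c (v *m invmx (symp c)).
  have [b b0 eb] := acts_as_symp d (v *m invmx (symp c)).
  rewrite -cd in eb; rewrite mulmxKV // in ea eb.
  have e : K *m pauli v = (a / b) *: (pauli v *m K).
    rewrite -[pauli v in LHS](mulmxK ud) -[X in K *m (X *m _)](scalerK b0).
    rewrite -eb -scalemxAl -scalemxAr !mulmxA eK ea -scalemxAl scalerA.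
    by rewrite mulrC -eK -!mulmxA mulmxV // mulmx1.
  have [s es] := pauli_sqr v.
  suff /eqP : (a / b) ^+ 2 = 1.
    rewrite sqrf_eq1 => /orP[]/eqP ab; [exists false | exists true]; by rewrite e ab.
  have : (-1) ^+ s *: ((a / b) ^+ 2 *: K) = (-1) ^+ s *: K.
    rewrite -[RHS]mulmx1 -scalemxAl scalemxAr -es mulmxA e -scalemxAl -mulmxA e.
    rewrite -scalemxAr mulmxA es -!scalemxAl mul1mx !scalerA; congr (_ *: _).
    by rewrite expr2 mulrC.
  move/(can_inj (signrZK s))/(congr1 (mulmx^~ (invmx K))).
  rewrite -scalemxAl mulmxV // => /matrixP/(_ x0 x0).
  by rewrite !mxE eqxx mulr1.
pose e i : 'rV['F_2]_(n + n) := delta_mx 0 i.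
pose bb i := K *m pauli (e i) == - (pauli (e i) *m K).
have bbP i : K *m pauli (e i) = (-1) ^+ bb i *: (pauli (e i) *m K).
  rewrite /bb; case: eqP => [->|]; first by rewrite scaleN1r.
  by case: (sgnK (e i)) => [[|]] ->; rewrite ?scaleN1r.
(* The halves are swapped because the sign against an X generator is read from the Z coordinate of
   [u], and conversely. *)
pose u : 'rV['F_2]_(n + n) :=
  row_mx (\row_l (bb (rshift n l))%:R) (\row_l (bb (lshift n l))%:R).
have [k ek] : exists k, pauli u *m K = k%:M.
  apply: commute_basis_scalar => i; rewrite -mulmxA bbP -scalemxAr.
  rewrite (mulmxA (pauli u) (pauli (e i))).
  have -> : pauli u *m pauli (e i) = (-1) ^+ bb i *: (pauli (e i) *m pauli u).
    have [l ->|l ->] := split_ordP i; have [ex ez] := pauli_comm_delta u l.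
      by rewrite ex row_mxEr mxE F2_nat_neq0.
    by rewrite ez row_mxEl mxE F2_nat_neq0.
  by rewrite -scalemxAl scalerA -signr_addb addbb scale1r mulmxA.
have [s es] := pauli_sqr u.
have N0 : (0 < #|{: basis n}|)%N by rewrite (leq_ltn_trans _ (ltn_ord x0)).
have nu : `|\det (pauli u)| = 1.
  by apply: norm_det_sqr; rewrite es scalemx1 det_scalar normrX normr_sign expr1n.
(* Taking determinants of [pauli u *m K] gives |k|^N = 1, where N > 0 is the number of basis
   states. *)
have nk : `|k| = 1.
  have := congr1 (fun U => `|\det U|) ek; rewrite det_mulmx normrM nu nK mulr1.
  by rewrite det_scalar normrX => /esym/eqP; rewrite pexpr_eq1 // => /eqP.
have [t nt [Q pQ eQ]] := pauli_is_pauli u.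
exists ((-1) ^+ s * k * t), Q; split=> //.
  by rewrite !normrM normr_sign nk nt !mulr1.
rewrite -eK; have -> : K = ((-1) ^+ s * k) *: pauli u.
  apply: (can_inj (signrZK s)).
  rewrite -[in LHS](mul1mx K) scalemxAl -es -mulmxA ek mul_mx_scalar scalerA.
  by rewrite mulrA -signr_addb addbb mul1r.
by rewrite eQ -!scalemxAl scalerA.
Qed.
End Unitary.

Theorem theorem13 (C : numClosedFieldType) (n : nat) (hn : (0 < n)%N)
    (c : circuit n) :
  (exists d : circuit n,
     layered [:: LP; LC; LP; LC; LH; LC; LP; LC; LP] d /\
     eq_mod_phase_pauli (unitary C c) (unitary C d)) /\
  (symp c \in Sp n /\
   exists d : circuit n,
     layered [:: LP; LC; LP; LC; LH; LC; LP; LC; LP] d /\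
     symp c = symp d).
Proof.
have [d [ld ed]] := sp_layers (sp_symp c).
split; first by exists d; split=> //; apply: eq_symp_unitary.
by split; [apply/sp_Sp/sp_symp | exists d].
Qed.
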